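(* There exist a two-dimensional real Banach space $X$, a real Banach space $Y$ which is a renorming of $c_0$ (that is, $Y$ is the vector space $c_0$ endowed with a norm equivalent to $\|\cdot\|_\infty$), and an element $u \in X \widetilde{\otimes}_\pi Y$ such that $u$ is an exposed point of the unit ball $B_{X \widetilde{\otimes}_\pi Y}$ and $u$ is not an elementary tensor, i.e. $u$ is not of the form $x \otimes y$ with $x \in X$, $y \in Y$.
   Context: All Banach spaces are real. $B_E$ denotes the closed unit ball of a Banach space $E$. The projective tensor product $X \widetilde{\otimes}_\pi Y$ is the completion of the algebraic tensor product $X \otimes Y$ with respect to the norm $\|u\|_\pi = \inf\{\sum_{j=1}^n \|x_j\|\,\|y_j\| : u = \sum_{j=1}^n x_j \otimes y_j,\ n\in\mathbb{N}\}$. A point $x$ of a convex set $A \subseteq E$ is an exposed point of $A$ if there is $f \in E^*$ with $f(x) > f(y)$ for every $y \in A \setminus \{x\}$. *)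

(* Defs.v *)
From HB Require Import structures.
From mathcomp Require Import all_boot all_order all_algebra.
From mathcomp Require Import all_classical all_reals all_analysis.

Set Implicit Arguments.
Unset Strict Implicit.
Unset Printing Implicit Defensive.

Import Order.TTheory GRing.Theory Num.Theory.
Import numFieldNormedType.Exports.

Local Open Scope classical_set_scope.
Local Open Scope ring_scope.

Section NullSequences.
Variable R : realType.

Definition null_seq : {pred (nat -> R)} :=
  mem [set x : nat -> R | x n @[n --> \oo] --> (0 : R)].

Fact null_seq_submod_closed : submod_closed null_seq.
Proof.
split=> [|a x y]; first by rewrite inE; exact: cvg_cst.
rewrite !inE /= => x0 y0; have -> : 0 = a * 0 + 0 :> R by rewrite mulr0 addr0.
by apply: cvgD => //; apply: cvgM => //; exact: cvg_cst.
Qed.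

HB.instance Definition _ :=
  GRing.isSubmodClosed.Build R (nat -> R) null_seq null_seq_submod_closed.

Record c0 := C0 { c0_seq :> nat -> R; _ : c0_seq \in null_seq }.

HB.instance Definition _ := [isSub for c0_seq].
HB.instance Definition _ := [Choice of c0 by <:].
HB.instance Definition _ := [SubChoice_isSubLmodule of c0 by <:].

Definition c0_norm (x : c0) : R := sup (range (fun n => `|x n|)).

End NullSequences.

(* The bijection [phi] identifies the vector space underlying [Y] with [c0];
   under this identification the norm of [Y] is a norm on [c0] equivalent to
   the supremum norm. *)
Definition renorming_of_c0 (R : realType) (Y : normedModType R) : Prop :=
  exists phi : {linear c0 R -> Y}, bijective phi /\
  exists a b : R, [/\ 0 < a, 0 < b &
    forall x : c0 R, a * c0_norm x <= `|phi x| <= b * c0_norm x].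

Definition has_dim (R : realType) (n : nat) (V : lmodType R) : Prop :=
  inhabited (Vector.axiom n V).

(* The algebraic tensor product, specified by its universal property, which
   determines it up to a unique linear isomorphism. *)
Record alg_tensor (R : realType) (X Y : lmodType R) := AlgTensor {
  alg_tensor_space :> lmodType R;
  tens : {bilinear X -> Y -> alg_tensor_space};
  tens_universal : forall (W : lmodType R) (b : {bilinear X -> Y -> W}),
    exists2 g : {linear alg_tensor_space -> W},
      forall x y, g (tens x y) = b x y &
      forall h : {linear alg_tensor_space -> W},
        (forall x y, h (tens x y) = b x y) -> h =1 g
}.

Definition proj_norm (R : realType) (X Y : normedModType R)
    (T : alg_tensor X Y) (t : T) : R :=
  inf [set r : R | exists2 s : seq (X * Y),
    t = \sum_(p <- s) tens T p.1 p.2 &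
    r = \sum_(p <- s) `|p.1| * `|p.2|].

(* A completion of the algebraic tensor product normed by [proj_norm]: a Banach
   space containing it isometrically as a dense subspace, hence unique up to a
   linear isometry. *)
Record proj_tensor (R : realType) (X Y : normedModType R) := ProjTensor {
  proj_tensor_alg : alg_tensor X Y;
  proj_tensor_space :> completeNormedModType R;
  proj_tensor_incl : {linear proj_tensor_alg -> proj_tensor_space};
  proj_tensor_incl_norm :
    forall t : proj_tensor_alg, `|proj_tensor_incl t| = proj_norm t;
  proj_tensor_incl_dense : dense (range proj_tensor_incl)
}.

Definition elementary_tensor (R : realType) (X Y : normedModType R)
    (P : proj_tensor X Y) (x : X) (y : Y) : P :=
  proj_tensor_incl P (tens (proj_tensor_alg P) x y).

Definition unit_ball (R : realType) (E : normedModType R) : set E :=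
  [set x | `|x| <= 1].

Definition exposed_point (R : realType) (E : normedModType R) (A : set E)
    (x : E) : Prop :=
  A x /\ exists f : {linear E -> R^o}, continuous f /\
    forall y, A y -> y <> x -> f y < f x.

(* Main.v *)
Require Import Defs.
From HB Require Import structures.
From mathcomp Require Import all_boot all_order all_algebra.
From mathcomp Require Import all_classical all_reals all_analysis.
From mathcomp Require Import ring lra.
Import Order.TTheory GRing.Theory Num.Theory.
Import numFieldNormedType.Exports.

(* [X] is the plane whose unit ball is the hexagon with
   vertices [+-x1, +-x2, +-x3], where [x1 + x2 + x3 = 0], and the exposing
   functional corresponds to an operator [X -> Y^*] of norm one sending [xn] to
   functionals [fn] that do not attain their norm on the ball of [Y]; on the
   ball of the bidual, each [fn] attains it at the single point [wn = 1 + vn],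
   where [1] is the constant sequence and [vn] is in [c0].  The maximisers of
   the functional on the ball of [X (x) Y^**] are then the convex combinations
   of the [xn (x) wn].  Such a combination lies in [X (x) Y] only if the
   coefficients [an] satisfy [a1 x1 + a2 x2 + a3 x3 = 0], i.e. are all equal to
   [1/3], so that the functional is maximal on the ball of [X (x) Y] at exactly
   one point, and this point has rank two.  Biduals are avoided by working with
   nearly optimal representations. *)

Set Implicit Arguments.
Unset Strict Implicit.
Unset Printing Implicit Defensive.

Local Open Scope classical_set_scope.
Local Open Scope ring_scope.

(** * Complete norms on a vector space *)

Section Renorming.
Variable R : realType.

(** Cauchy filters are expressed through the bare function [N], so that completeness can be proved
    before any topology is put on the space. *)
Definition norm_complete (V : zmodType) (N : V -> R) : Prop :=
  forall F : set_system V, ProperFilter F ->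
    (forall e : R, 0 < e -> exists x, F [set y | N (x - y) < e]) ->
    exists l, forall e : R, 0 < e -> F [set y | N (l - y) < e].

Record banach_norm (V : lmodType R) := BanachNorm {
  bnorm :> V -> R;
  bnormD : forall x y, bnorm (x + y) <= bnorm x + bnorm y;
  bnormZ : forall a x, bnorm (a *: x) = `|a| * bnorm x;
  bnorm0_eq0 : forall x, bnorm x = 0 -> x = 0;
  bnorm_complete : norm_complete bnorm }.

(** A type alias carrying [N], which keeps the new norm apart from any structure already attached to
    [V], such as the product norm on the plane. *)
Definition renormed (V : lmodType R) (N : banach_norm V) : Type := V.

Section Instances.
Variables (V : lmodType R) (N : banach_norm V).
HB.instance Definition _ := GRing.Lmodule.on (renormed N).
HB.instance Definition _ := Lmodule_isNormed.Build R (renormed N)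
  (@bnormD V N) (@bnormZ V N) (@bnorm0_eq0 V N).

Fact renormed_cauchy_cvg (F : set_system (renormed N)) :
  ProperFilter F -> cauchy F -> cvg F.
Proof.
move=> FF Fc.
have [|l lF] := @bnorm_complete V N F FF.
  move=> e e0; have [x Fx] := (cauchyP F).1 Fc e e0.
  by exists x; move: Fx; rewrite -ball_normE.
apply/cvg_ex; exists l; apply/cvgrPdist_lt => e e0.
exact: lF.
Qed.

HB.instance Definition _ := Uniform_isComplete.Build (renormed N)
  renormed_cauchy_cvg.
End Instances.

Definition renormed_banach V (N : banach_norm V) : completeNormedModType R :=
  renormed N.

Lemma scalar_norm_complete : norm_complete (fun x : R => `|x|).
Proof.
move=> F FF Fc.
have Fcauchy : cauchy (F : set_system R^o).
  apply: cauchy_exP => e e0; have [x Fx] := Fc _ e0.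
  by exists x; rewrite -ball_normE.
have /cvg_ex[l /cvgrPdist_lt lF] := @cauchy_cvg R^o F FF Fcauchy.
by exists l => e e0; exact: lF.
Qed.

(** The hypotheses make [N] equivalent to the sum of the component norms, so limits can be taken in
    each component. Both the plane and the tensor product are handled this way. *)
Lemma prod_norm_complete (V W : zmodType) (NV : V -> R) (NW : W -> R)
    (N : V * W -> R) (C : R) : 0 < C ->
  (forall x, NV x.1 <= C * N x) -> (forall x, NW x.2 <= C * N x) ->
  (forall x, N x <= C * (NV x.1 + NW x.2)) ->
  norm_complete NV -> norm_complete NW -> norm_complete N.
Proof.
move=> C0 le1 le2 leN cV cW F FF Fc.
have [|l1 Fl1] := cV (fst @ F) _.
  move=> e e0; have [x Fx] := Fc _ (divr_gt0 e0 C0).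
  exists x.1; move: Fx; apply: (@filterS _ F) => y /=.
  rewrite ltr_pdivlMr// mulrC; exact: le_lt_trans (le1 (x - y)).
have [|l2 Fl2] := cW (snd @ F) _.
  move=> e e0; have [x Fx] := Fc _ (divr_gt0 e0 C0).
  exists x.2; move: Fx; apply: (@filterS _ F) => y /=.
  rewrite ltr_pdivlMr// mulrC.
  exact: le_lt_trans (le2 (x - y)).
exists (l1, l2) => e e0; have e1 := divr_gt0 e0 (mulr_gt0 C0 (ltr0Sn R 1)).
have F1 : F [set y | NV (l1 - y.1) < e / (C * 2)] := Fl1 _ e1.
have F2 : F [set y | NW (l2 - y.2) < e / (C * 2)] := Fl2 _ e1.
apply: filterS (filterI F1 F2) => y [/= y1 y2].
apply: le_lt_trans (leN _) _ => /=.
have -> : e = C * (e / (C * 2) + e / (C * 2)) by field; rewrite gt_eqF.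
by rewrite ltr_pM2l// ltrD.
Qed.

End Renorming.

(* Prevents [/=] from unfolding the operations of [c0] to those of sequences. *)
Arguments c0_seq {R} : simpl never.

(** * Coordinates, truncations and completeness in [c0] *)

Section NullSequences.
Variable R : realType.
Implicit Types x y : c0 R.

Lemma c0P x y : (forall k, x k = y k) -> x = y.
Proof. by move=> xy; apply/val_inj/funext. Qed.

Lemma c0D x y k : (x + y) k = x k + y k. Proof. by []. Qed.
Lemma c0N x k : (- x) k = - x k. Proof. by []. Qed.
Lemma c0Z a x k : (a *: x) k = a * x k. Proof. by []. Qed.

Lemma c0_cvg x : x n @[n --> \oo] --> (0 : R).
Proof. by have := valP x; rewrite inE. Qed.

Definition finite_c0 (f : nat -> R) (K : nat) : c0 R.
Proof.
refine (@C0 R (fun k => if (k < K)%N then f k else 0) _).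
rewrite inE /=; apply/cvgrPdist_lt => e e0; exists K => // n /= Kn.
by rewrite ltnNge Kn /= subrr normr0.
Defined.

Lemma finite_c0E f K k : finite_c0 f K k = if (k < K)%N then f k else 0.
Proof. by []. Qed.

Lemma c0_bounded x : has_ubound (range (fun n => `|x n|)).
Proof.
have /cvgrPdist_lt/(_ 1 ltr01) [K _ xK] := c0_cvg x.
exists (1 + \sum_(k < K) `|x k|) => _ [k _ <-].
have [kK|Kk] := ltnP k K.
  rewrite (bigD1 (Ordinal kK)) //= addrCA lerDl addr_ge0//.
  by apply: sumr_ge0.
have := xK _ Kk; rewrite /= sub0r normrN => /ltW/le_trans; apply.
by rewrite lerDl sumr_ge0.
Qed.

Lemma le_c0_norm x k : `|x k| <= c0_norm x.
Proof. by apply: ub_le_sup; [exact: c0_bounded | exists k]. Qed.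

Lemma c0_norm_le x (M : R) : (forall k, `|x k| <= M) -> c0_norm x <= M.
Proof.
by move=> xM; apply: ge_sup => [|_ [k _ <-]//]; exists `|x 0%N|, 0%N.
Qed.

(** The limit is built coordinatewise from completeness of the scalars. It is uniformly close to
    elements of [c0], hence is itself null. *)
Lemma c0_norm_complete (N : c0 R -> R) (C : R) : 0 < C ->
  (forall x, c0_norm x <= N x) -> (forall x, N x <= C * c0_norm x) ->
  norm_complete N.
Proof.
move=> C_gt0 leN Nle F FF Fc.
have /choice[l Fl] (k : nat) : exists l : R,
    forall e : R, 0 < e -> F [set y | `|l - y k| < e].
  have [|l Fl] := @scalar_norm_complete R ((fun x : c0 R => x k) @ F) _.
    move=> e e0; have [x Fx] := Fc _ e0; exists (x k).
    move: Fx; apply: (@filterS _ F) => y /=; apply: le_lt_trans.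
    by apply: le_trans (leN _); exact: (le_c0_norm (x - y)).
  by exists l.
have near_l e : 0 < e -> exists x, F [set y | N (x - y) < e] /\
    forall k, `|l k - x k| <= e.
  move=> e0; have [x Fx] := Fc _ e0; exists x; split => // k.
  apply/ler_addgt0Pr => d d0.
  have [y [/= xy ly]] := filter_ex (filterI Fx (Fl k _ d0)).
  have {}xy : `|x k - y k| < e.
    apply: le_lt_trans xy; apply: le_trans (leN _).
    exact: (le_c0_norm (x - y)).
  have -> : l k - x k = (l k - y k) - (x k - y k) by ring.
  by apply: le_trans (ler_normB _ _) _; rewrite addrC lerD // ltW.
have lc0 : l \in @null_seq R.
  rewrite inE /=; apply/cvgrPdist_lt => e e0.
  have e2 : 0 < e / 2 by rewrite divr_gt0.
  have [x [_ lx]] := near_l _ e2.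
  have /cvgrPdist_lt/(_ _ e2) := c0_cvg x.
  apply: filterS => n; rewrite !sub0r !normrN => xn.
  have -> : l n = (l n - x n) + x n by ring.
  apply: le_lt_trans (ler_normD _ _) _.
  by rewrite (splitr e) ler_ltD.
exists (C0 lc0) => e e0.
have e2 : 0 < e / (C * 4) by rewrite divr_gt0 ?mulr_gt0.
have [x [Fx lx]] := near_l _ e2.
apply: filterS Fx => y /= xy.
apply: le_lt_trans (Nle _) _.
have : c0_norm (C0 lc0 - y) <= e / (C * 4) + e / (C * 4).
  apply: c0_norm_le => k; rewrite c0D c0N.
  have -> : C0 lc0 k - y k = (l k - x k) + (x k - y k).
    by change (l k - y k = (l k - x k) + (x k - y k)); ring.
  apply: le_trans (ler_normD _ _) _; apply: lerD => //.
  apply: le_trans (ltW xy); apply: le_trans (leN _).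
  exact: (le_c0_norm (x - y)).
rewrite -(ler_pM2l C_gt0) => /le_lt_trans; apply.
have -> : C * (e / (C * 4) + e / (C * 4)) = e / 2 by field; rewrite gt_eqF.
lra.
Qed.

End NullSequences.

(** * The hexagonal norm on the plane and the equivalent norm on [c0] *)

Inductive vertex := V1 | V2 | V3.

Section Norms.
Variable R : realType.
Implicit Types (x y : c0 R) (p q : R * R) (n m : vertex).

Definition hexv n : R * R :=
  match n with V1 => (1, 0) | V2 => (0, 1) | V3 => (-1, -1) end.

(** The gauge of the hexagon with vertices [hexv n] and their opposites; each term of the maximum
    corresponds to a pair of parallel sides. *)
Definition hex_norm p : R :=
  Num.max `|p.1 - p.2| (Num.max `|p.1| `|p.2|).

Lemma hex_norm_leP p M :
  reflect [/\ `|p.1 - p.2| <= M, `|p.1| <= M & `|p.2| <= M] (hex_norm p <= M).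
Proof. by rewrite /hex_norm !ge_max; exact: and3P. Qed.

Lemma hex_norm_ge p :
  [/\ `|p.1 - p.2| <= hex_norm p, `|p.1| <= hex_norm p & `|p.2| <= hex_norm p].
Proof. exact/hex_norm_leP. Qed.

Lemma hex_normD p q : hex_norm (p + q) <= hex_norm p + hex_norm q.
Proof.
have [p0 p1 p2] := hex_norm_ge p; have [q0 q1 q2] := hex_norm_ge q.
apply/hex_norm_leP; split => /=; last 2 first.
- by apply: le_trans (ler_normD _ _) _; apply: lerD.
- by apply: le_trans (ler_normD _ _) _; apply: lerD.
by rewrite opprD addrACA; apply: le_trans (ler_normD _ _) _; apply: lerD.
Qed.

Lemma hex_normZ a p : hex_norm (a *: p) = `|a| * hex_norm p.
Proof.
by rewrite /hex_norm /= -scalerBr /GRing.scale /= !normrM -!maxr_pMr.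
Qed.

Lemma hex_norm0_eq0 p : hex_norm p = 0 -> p = 0.
Proof.
case: p => a b h; have [_] := hex_norm_ge (a, b); rewrite h /= !normr_le0.
by move=> /eqP -> /eqP ->.
Qed.

Lemma hex_norm_complete : norm_complete hex_norm.
Proof.
apply: (@prod_norm_complete R R R Num.norm Num.norm _ 1) => //; last 2 first.
- exact: scalar_norm_complete.
- exact: scalar_norm_complete.
- by move=> p; rewrite mul1r; have [] := hex_norm_ge p.
- by move=> p; rewrite mul1r; have [] := hex_norm_ge p.
move=> p; rewrite mul1r; apply/hex_norm_leP; split.
- exact: ler_normB.
- by rewrite lerDl.
- by rewrite lerDr.
Qed.

Lemma hex_norm_hexv n : hex_norm (hexv n) <= 1.
Proof.
by apply/hex_norm_leP; case: n; split; rewrite /= ?subr0 ?sub0r ?subrr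
  ?normrN ?normr1 ?normr0 ?ler01.
Qed.

(* The translation [s] is minus the median of [p.1], [p.2] and [0]. *)
Lemma hex_norm_decomp p : exists s : R,
  `|p.1 + s| + `|p.2 + s| + `|s| <= hex_norm p.
Proof.
case: p => a b; have [/=] := hex_norm_ge (a, b).
move: (hex_norm _) => M; rewrite !ler_norml.
move=> /andP[h1 h2] /andP[h3 h4] /andP[h5 h6].
(* Here [a + s], [b + s] and [s] are the coefficients of [p] on the three vertices. In each case one
   of them vanishes and the other two have opposite signs, so the sum of absolute values is a
   difference bounded by [M]. *)
have key (s : R) : [\/ [/\ a + s <= 0, 0 <= b + s & s = 0] ,
   [/\ 0 <= a + s, b + s <= 0 & s = 0],
   [/\ a + s = 0 & (0 <= s /\ b + s <= 0 \/ s <= 0 /\ 0 <= b + s)] |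
   [/\ b + s = 0 & (0 <= s /\ a + s <= 0 \/ s <= 0 /\ 0 <= a + s)]] ->
  `|a + s| + `|b + s| + `|s| <= M.
  by case => [[? ? ?]|[? ? ?]|[? [[? ?]|[? ?]]]|[? [[? ?]|[? ?]]]];
     do 3 (case: ler0P => ?; try lra).
have [a0|a0] := leP 0 a; have [b0|b0] := leP 0 b;
  have [ab|ab] := leP a b.
- by exists (- a); apply: key; apply: Or43; split; [lra | right; lra].
- by exists (- b); apply: key; apply: Or44; split; [lra | right; lra].
- by exists 0; apply: key; apply: Or42; split; lra.
- by exists 0; apply: key; apply: Or42; split; lra.
- by exists 0; apply: key; apply: Or41; split; lra.
- by exists 0; apply: key; apply: Or41; split; lra.
- by exists (- b); apply: key; apply: Or44; split; [lra | left; lra].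
- by exists (- a); apply: key; apply: Or43; split; [lra | left; lra].
Qed.

Definition hex_banach : banach_norm (R * R)%type :=
  BanachNorm hex_normD hex_normZ hex_norm0_eq0 hex_norm_complete.

(* [hexf n] is the image of the vertex [n] under the exposing operator
   [X -> Y^*]; its norm is attained on the ball of the bidual of [Y] only
   at [hexw n], which does not belong to [c0]. *)
Definition hexf n y : R := (hexv n).1 * y 0%N + (hexv n).2 * y 1%N.

(** The first two entries make [hexf m] take at [hexw n] the value 1 if [m = n] and -1/2
    otherwise. *)
Definition hexw n (k : nat) : R :=
  match k with
  | 0%N => (hexv n).1 - (hexv n).2 / 2
  | 1%N => (hexv n).2 - (hexv n).1 / 2
  | _ => 1
  end.

(* The functionals indexed by [(n, k, true)] and [(n, k, false)] together bound
   [|hexf n y| + weight k * |y k - hexw n k * hexf n y|], so that the elements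
   of the ball nearly maximising [hexf n] are close to [hexw n] at each
   coordinate.  As [weight] tends to 0, [hexw n] is still a pointwise limit of
   elements of [c0] whose norms tend to 1. *)
Definition weight (k : nat) : R := (k.+3)%:R^-1.

Definition functional (i : nat + vertex * nat * bool) y : R :=
  match i with
  | inl k => y k
  | inr (n, k, b) =>
      hexf n y + (-1) ^+ b * weight k * (y k - hexw n k * hexf n y)
  end.

Definition c0_renorm y : R := sup (range (fun i => `|functional i y|)).

Lemma weight_gt0 k : 0 < weight k.
Proof. by rewrite invr_gt0. Qed.

Lemma weight_le k : weight k <= 3^-1.
Proof. by rewrite lef_pV2 ?posrE// ler_nat. Qed.

Lemma weight_decr k l : (k <= l)%N -> weight l <= weight k.
Proof. by move=> kl; rewrite lef_pV2 ?posrE// ler_nat !ltnS. Qed.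

Lemma hexw_le1 n k : `|hexw n k| <= 1.
Proof. by case: k => [|[|k]]; case: n => /=; rewrite ler_norml; lra. Qed.

Lemma hexf_linear n a x y : hexf n (a *: x + y) = a * hexf n x + hexf n y.
Proof. by rewrite /hexf !c0D !c0Z; ring. Qed.

(** The right-hand side is the value of the exposing functional at the tensor that pairs the three
    vertices with [x], [y], [z]. *)
Lemma hexf_sum x y z :
  hexf V1 x + hexf V2 y + hexf V3 z = (x - z) 0%N + (y - z) 1%N.
Proof. by rewrite /hexf !c0D !c0N /=; ring. Qed.

Lemma functional_linear i a x y :
  functional i (a *: x + y) = a * functional i x + functional i y.
Proof.
case: i => [k|[[n k] b]]; rewrite /functional; first by rewrite c0D c0Z.
by rewrite hexf_linear c0D c0Z; ring.
Qed.

Lemma hexf_le n y : `|hexf n y| <= 2 * c0_norm y.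
Proof.
have := le_c0_norm y 0; have := le_c0_norm y 1; rewrite !ler_norml.
move=> /andP[? ?] /andP[? ?]; case: n; rewrite /hexf /=; apply/andP; split; lra.
Qed.

(** The constant is 2 from [hexf_le] plus 1/3 times 3 from the weighted deviation. *)
Lemma functional_le i y : `|functional i y| <= 3 * c0_norm y.
Proof.
have y0 : 0 <= c0_norm y by apply: le_trans (le_c0_norm y 0).
case: i => [k|[[n k] b]] /=.
  by apply: le_trans (le_c0_norm y k) _; lra.
have fy := hexf_le n y.
have dy : `|y k - hexw n k * hexf n y| <= 3 * c0_norm y.
  apply: le_trans (ler_normB _ _) _; rewrite normrM.
  have -> : 3 * c0_norm y = c0_norm y + 1 * (2 * c0_norm y) by ring.
  by rewrite lerD ?le_c0_norm// ler_pM ?hexw_le1.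
apply: le_trans (ler_normD _ _) _; rewrite !normrM normr_sign mul1r.
rewrite (gtr0_norm (weight_gt0 k)).
have -> : 3 * c0_norm y = 2 * c0_norm y + 3^-1 * (3 * c0_norm y) by field.
by rewrite lerD// ler_pM ?weight_le// ltW// weight_gt0.
Qed.

Lemma le_c0_renorm i y : `|functional i y| <= c0_renorm y.
Proof.
apply: ub_le_sup; last by exists i.
by exists (3 * c0_norm y) => _ [j _ <-]; exact: functional_le.
Qed.

Lemma c0_renorm_ge0 y : 0 <= c0_renorm y.
Proof. exact: le_trans (le_c0_renorm (inl 0%N) y). Qed.

Lemma c0_renorm_le y M : (forall i, `|functional i y| <= M) -> c0_renorm y <= M.
Proof.
move=> yM; apply: ge_sup => [|_ [i _ <-]//].
by exists `|functional (inl 0%N) y|, (inl 0%N).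
Qed.

Lemma c0_norm_le_renorm y : c0_norm y <= c0_renorm y.
Proof. by apply: c0_norm_le => k; exact: (le_c0_renorm (inl k)). Qed.

Lemma c0_renorm_le_norm y : c0_renorm y <= 3 * c0_norm y.
Proof. by apply: c0_renorm_le => i; exact: functional_le. Qed.

Lemma c0_renormD x y : c0_renorm (x + y) <= c0_renorm x + c0_renorm y.
Proof.
apply: c0_renorm_le => i; rewrite -[x]scale1r functional_linear mul1r scale1r.
by apply: le_trans (ler_normD _ _) _; rewrite lerD ?le_c0_renorm.
Qed.

Lemma c0_renormZ a y : c0_renorm (a *: y) = `|a| * c0_renorm y.
Proof.
have le b x : c0_renorm (b *: x) <= `|b| * c0_renorm x.
  apply: c0_renorm_le => i; rewrite -[b *: x]addr0 functional_linear.
  have -> : functional i 0 = 0.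
    by have := functional_linear i (-1) 0 0; rewrite scaler0 add0r mulN1r addNr.
  by rewrite addr0 normrM ler_wpM2l ?le_c0_renorm.
apply/eqP; rewrite eq_le le /=.
have [->|a0] := eqVneq a 0.
  rewrite normr0 mul0r; apply: le_trans (le_c0_renorm (inl 0%N) _) => //.
rewrite -ler_pdivlMl ?normr_gt0// -normfV.
by apply: le_trans (le a^-1 (a *: y)); rewrite scalerA mulVf// scale1r.
Qed.

Lemma c0_renorm0 : c0_renorm 0 = 0.
Proof. by have := c0_renormZ 0 0; rewrite scaler0 normr0 mul0r. Qed.

Lemma c0_renorm0_eq0 y : c0_renorm y = 0 -> y = 0.
Proof.
move=> y0; apply: c0P => k; apply/eqP; rewrite -normr_le0 -y0.
exact: (le_c0_renorm (inl k)).
Qed.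

Definition c0_banach : banach_norm (c0 R) :=
  BanachNorm c0_renormD c0_renormZ c0_renorm0_eq0
    (c0_norm_complete (ltr0Sn R 2) c0_norm_le_renorm c0_renorm_le_norm).

(** The two signs [b] bound both [|f + d|] and [|f - d|], whose maximum is [|f| + |d|]. *)
Lemma hexf_deviation n y k :
  `|hexf n y| + weight k * `|y k - hexw n k * hexf n y| <= c0_renorm y.
Proof.
have := le_c0_renorm (inr (n, k, false)) y.
have := le_c0_renorm (inr (n, k, true)) y.
rewrite /= expr0 expr1 mulN1r mul1r mulNr.
rewrite -[weight k in X in _ -> _ -> X](gtr0_norm (weight_gt0 k)) -normrM.
move: (hexf n y) (weight k * _) (c0_renorm y) => f d M.
rewrite !ler_norml => /andP[? ?] /andP[? ?].
by case: (ler0P f) => ?; case: (ler0P d) => ?; lra.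
Qed.

(** Truncating at [K] matters only for [m = n] and [k >= K], where the deviation costs at most
    [weight K]. Since [2 <= K], the entries read by [hexf] survive. *)
Lemma c0_renorm_hexw n K : (2 <= K)%N ->
  c0_renorm (finite_c0 (hexw n) K) <= 1 + weight K.
Proof.
move=> K2; have wK := weight_gt0 K.
have fE m : hexf m (finite_c0 (hexw n) K) =
    (hexv m).1 * hexw n 0 + (hexv m).2 * hexw n 1.
  by rewrite /hexf !finite_c0E (ltnW K2) K2.
have zle k : `|finite_c0 (hexw n) K k| <= 1.
  by rewrite finite_c0E; case: ifP; rewrite ?hexw_le1 ?normr0.
apply: c0_renorm_le => -[k|[[m k] b]].
  by apply: le_trans (zle k) _; lra.
rewrite /functional.
apply: le_trans (ler_normD _ _) _; rewrite !normrM normr_sign mul1r.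
rewrite (gtr0_norm (weight_gt0 k)) fE.
have [mn|mn] : m = n \/
    `|(hexv m).1 * hexw n 0 + (hexv m).2 * hexw n 1| <= 2^-1.
  by case: m {fE}; case: n {zle};
    first [by left | by right; rewrite /= ler_norml; lra].
- have -> : (hexv m).1 * hexw n 0 + (hexv m).2 * hexw n 1 = 1.
    by rewrite mn; case: n {fE zle mn} => /=; lra.
  rewrite normr1 lerD2l mulr1 finite_c0E; case: ltnP => [kK|Kk].
    by rewrite mn subrr normr0 mulr0 ltW.
  rewrite sub0r normrN -[weight K]mulr1 ler_pM ?hexw_le1 ?weight_decr//.
  by rewrite ltW// weight_gt0.
move: ((hexv m).1 * _ + _) mn => f f2.
(* For [m] distinct from [n] the total is at most 1/2 + (1/3)(1 + 1/2) = 1; this is where the bound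
   1/3 on the weights is tight. *)
have : weight k * `|finite_c0 (hexw n) K k - hexw m k * f| <=
    3^-1 * (1 + 1 * 2^-1).
  apply: ler_pM; rewrite ?weight_le//; first by rewrite ltW// weight_gt0.
  apply: le_trans (ler_normB _ _) _; rewrite normrM lerD// ler_pM ?hexw_le1//.
lra.
Qed.

End Norms.

(** * General properties of the projective norm *)

Section ProjectiveNorm.
Variables (R : realType) (X Y : normedModType R) (T : alg_tensor X Y).
Implicit Types (s : seq (X * Y)) (t : T).

Let cost s : R := \sum_(p <- s) `|p.1| * `|p.2|.
Let value s : T := \sum_(p <- s) tens T p.1 p.2.

Let cost_ge0 s : 0 <= cost s.
Proof. by apply: sumr_ge0 => p _; rewrite mulr_ge0. Qed.

Let norms t := [set r : R | exists2 s, t = value s & r = cost s].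

Let norms_lbound t : has_lbound (norms t).
Proof. by exists 0 => _ [s _ ->]. Qed.

Lemma proj_norm_le s :
  proj_norm (\sum_(p <- s) tens T p.1 p.2) <= \sum_(p <- s) `|p.1| * `|p.2|.
Proof. by apply: ge_inf; [exact: norms_lbound | exists s]. Qed.

Lemma proj_norm_tens x y : proj_norm (tens T x y) <= `|x| * `|y|.
Proof. by have := proj_norm_le [:: (x, y)]; rewrite !big_seq1. Qed.

(** Every tensor has a representation, so the infimum defining [proj_norm] is over a nonempty set
    and is not a default value. *)
Hypothesis T_spanned : forall t, exists s, t = \sum_(p <- s) tens T p.1 p.2.

Lemma proj_norm_approx t (e : R) : 0 < e -> exists s,
  t = \sum_(p <- s) tens T p.1 p.2 /\
  \sum_(p <- s) `|p.1| * `|p.2| < proj_norm t + e.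
Proof.
move=> e0; have [|_ [s ts ->] se] := @inf_adherent R (norms t) e e0.
  split; last exact: norms_lbound.
  by have [s ts] := T_spanned t; exists (cost s), s.
by exists s.
Qed.

Lemma proj_normD t u : proj_norm (t + u) <= proj_norm t + proj_norm u.
Proof.
apply/ler_addgt0Pr => e e0; have e2 : 0 < e / 2 by rewrite divr_gt0.
have [s [ts se]] := proj_norm_approx t e2.
have [r [ur re]] := proj_norm_approx u e2.
have := proj_norm_le (s ++ r); rewrite !big_cat /= -ts -ur => /le_trans; apply.
by rewrite [e]splitr addrACA lerD ?ltW.
Qed.

Lemma proj_normZ a t : proj_norm (a *: t) = `|a| * proj_norm t.
Proof.
have le (b : R) (u : T) : proj_norm (b *: u) <= `|b| * proj_norm u.
  apply/ler_addgt0Pr => e e0.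
  have e1 : 0 < e / (`|b| + 1) by rewrite divr_gt0// ltr_wpDl.
  have [s [us se]] := proj_norm_approx u e1.
  have := proj_norm_le [seq (b *: p.1, p.2) | p <- s].
  rewrite !big_map /=; under eq_bigr do rewrite linearZl_LR.
  under [X in _ <= X]eq_bigr do rewrite normrZ -mulrA.
  rewrite -scaler_sumr -mulr_sumr -us => /le_trans; apply.
  apply: le_trans (ler_wpM2l (normr_ge0 b) (ltW se)) _.
  rewrite mulrDr lerD2l mulrA ler_pdivrMr ?ltr_wpDl// mulrC.
  by rewrite ler_wpM2l ?(ltW e0)// lerDl.
apply/eqP; rewrite eq_le le /=.
have [->|a0] := eqVneq a 0.
  rewrite normr0 mul0r; apply: lb_le_inf => [|_ [s _ ->]]; last exact: cost_ge0.
  by have [s ts] := T_spanned (0 *: t); exists (cost s), s.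
rewrite -ler_pdivlMl ?normr_gt0// -normfV.
by apply: le_trans (le a^-1 (a *: t)); rewrite scalerA mulVf// scale1r.
Qed.

(** Maximality of the projective norm: subadditivity carries the bound on elementary tensors over to
    every representation. *)
Lemma proj_norm_ge (q : T -> R) t :
  q 0 <= 0 -> (forall u v, q (u + v) <= q u + q v) ->
  (forall x y, q (tens T x y) <= `|x| * `|y|) -> q t <= proj_norm t.
Proof.
move=> q0 qD qt; apply/ler_addgt0Pr => e e0.
have [s [-> se]] := proj_norm_approx t e0.
apply: le_trans (ltW se); elim: {se} s => [|p s IH]; first by rewrite !big_nil.
by rewrite !big_cons; apply: le_trans (qD _ _) _; rewrite lerD.
Qed.

End ProjectiveNorm.

(** * A concrete model of the projective tensor product *)

Section Tensor.
Variable R : realType.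

(** The identity, retyped to serve both as the renorming bijection and as the inclusion into the
    completion. *)
Definition to_renormed (V : lmodType R) (N : banach_norm V) (x : V) :
  renormed N := x.

Fact to_renormed_linear (V : lmodType R) (N : banach_norm V) :
  linear (@to_renormed V N).
Proof. by []. Qed.

HB.instance Definition _ (V : lmodType R) (N : banach_norm V) :=
  GRing.isLinear.Build R V (renormed N) *:%R (@to_renormed V N)
    (@to_renormed_linear V N).

Definition hexX : completeNormedModType R := renormed_banach (hex_banach R).
Definition c0Y : completeNormedModType R := renormed_banach (c0_banach R).

(** Since [X] has basis [hexv V1], [hexv V2], a pair [t] encodes the tensor
    [x1 (x) t.1 + x2 (x) t.2]. *)
Definition c0_pair : lmodType R := (c0 R * c0 R)%type.

Definition pair_tens (x : hexX) (y : c0Y) : c0_pair :=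
  (x.1 *: (y : c0 R), x.2 *: (y : c0 R)).

Fact pair_tens_bilinear : bilinear_for *:%R *:%R pair_tens.
Proof.
split=> [y a x x'|x a y y']; apply: injective_projections => /=.
- by rewrite scalerDl scalerA.
- by rewrite scalerDl scalerA.
- by rewrite scalerDr !scalerA mulrC.
- by rewrite scalerDr !scalerA mulrC.
Qed.

HB.instance Definition _ :=
  bilinear_isBilinear.Build R hexX c0Y c0_pair *:%R *:%R
    pair_tens pair_tens_bilinear.

Lemma pair_tensE (t : c0_pair) : t =
  pair_tens (hexv R V1 : hexX) t.1 + pair_tens (hexv R V2 : hexX) t.2.
Proof.
case: t => t1 t2; apply: injective_projections.
  by rewrite /= scale1r scale0r addr0.
by rewrite /= scale1r scale0r add0r.
Qed.

Section Universal.
Variables (W : lmodType R) (b : {bilinear hexX -> c0Y -> W}).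

Definition pair_lift (t : c0_pair) : W :=
  b (hexv R V1 : hexX) t.1 + b (hexv R V2 : hexX) t.2.

Fact pair_lift_linear : linear pair_lift.
Proof.
move=> a t u; rewrite /pair_lift /= !linearPr /= scalerDr.
by rewrite -!addrA; congr (_ + _); rewrite addrCA.
Qed.

HB.instance Definition _ :=
  GRing.isLinear.Build R c0_pair W *:%R pair_lift pair_lift_linear.

End Universal.

Lemma pair_tens_universal (W : lmodType R) (b : {bilinear hexX -> c0Y -> W}) :
  exists2 g : {linear c0_pair -> W}, forall x y, g (pair_tens x y) = b x y &
  forall h : {linear c0_pair -> W},
    (forall x y, h (pair_tens x y) = b x y) -> h =1 g.
Proof.
exists (pair_lift b) => [x y|h hb t]; last first.
  by rewrite [in LHS](pair_tensE t) raddfD /= !hb.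
rewrite /= /pair_lift /= !linearZr_LR -!linearZl_LR -linearDl.
congr (b _ y); apply: injective_projections.
  by change (x.1 * 1 + x.2 * 0 = x.1); rewrite mulr1 mulr0 addr0.
by change (x.1 * 0 + x.2 * 1 = x.2); rewrite mulr1 mulr0 add0r.
Qed.

Definition pair_alg_tensor : alg_tensor hexX c0Y :=
  AlgTensor pair_tens_universal.

Notation proj := (@proj_norm R hexX c0Y pair_alg_tensor).

Lemma pair_spanned (t : pair_alg_tensor) :
  exists s, t = \sum_(p <- s) tens pair_alg_tensor p.1 p.2.
Proof.
exists [:: (hexv R V1 : hexX, t.1 : c0Y); (hexv R V2 : hexX, t.2 : c0Y)].
by rewrite big_cons big_seq1; exact: pair_tensE.
Qed.

(** The coordinate functionals of the plane have norm at most one, so each component map is a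
    contraction on elementary tensors. *)
Lemma proj_component (t : c0_pair) :
  c0_renorm t.1 <= proj t /\ c0_renorm t.2 <= proj t.
Proof.
split.
  apply: (proj_norm_ge pair_spanned (q := fun u : c0_pair => c0_renorm u.1)).
  - by rewrite c0_renorm0.
  - by move=> u v; exact: c0_renormD.
  - move=> x y; rewrite c0_renormZ ler_wpM2r ?c0_renorm_ge0//.
    by have [] := hex_norm_ge x.
apply: (proj_norm_ge pair_spanned (q := fun u : c0_pair => c0_renorm u.2)).
- by rewrite c0_renorm0.
- by move=> u v; exact: c0_renormD.
- move=> x y; rewrite c0_renormZ ler_wpM2r ?c0_renorm_ge0//.
  by have [] := hex_norm_ge x.
Qed.

Lemma proj_pair_tens n (y : c0 R) :
  proj (pair_tens (hexv R n : hexX) (y : c0Y)) <= c0_renorm y.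
Proof.
apply: le_trans (proj_norm_tens pair_alg_tensor _ _) _.
change (hex_norm (hexv R n) * c0_renorm y <= c0_renorm y).
by rewrite ler_piMl ?hex_norm_hexv ?c0_renorm_ge0.
Qed.

Lemma proj_le (t : c0_pair) : proj t <= c0_renorm t.1 + c0_renorm t.2.
Proof.
rewrite [X in proj X](pair_tensE t).
apply: le_trans (proj_normD pair_spanned _ _) _.
by apply: lerD; exact: proj_pair_tens.
Qed.

Lemma proj0_eq0 (t : c0_pair) : proj t = 0 -> t = 0.
Proof.
have [le1 le2] := proj_component t => t0; rewrite t0 in le1 le2.
by apply: injective_projections; apply: c0_renorm0_eq0; apply/eqP;
  rewrite eq_le c0_renorm_ge0 andbT.
Qed.

(** The projective norm is equivalent to the sum of the component norms. The algebraic tensor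
    product is thus already complete and serves as its own completion. *)
Lemma proj_complete : norm_complete (proj : c0_pair -> R).
Proof.
have c0Yc := @bnorm_complete R _ (c0_banach R).
apply: (@prod_norm_complete R (c0 R) (c0 R) (@c0_renorm R) (@c0_renorm R) proj
  1 ltr01) => //.
- by move=> t; rewrite mul1r; have [] := proj_component t.
- by move=> t; rewrite mul1r; have [] := proj_component t.
- by move=> t; rewrite mul1r; exact: proj_le.
Qed.

Definition proj_banach : banach_norm c0_pair :=
  BanachNorm (proj_normD pair_spanned) (proj_normZ pair_spanned)
    proj0_eq0 proj_complete.

Definition pairP : completeNormedModType R := renormed_banach proj_banach.

Fact to_renormed_dense : dense (range (@to_renormed c0_pair proj_banach)).
Proof. by move=> O [x Ox] _; exists x; split => //; exists x. Qed.

Definition pair_proj_tensor : proj_tensor hexX c0Y :=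
  @ProjTensor R hexX c0Y pair_alg_tensor pairP
   (@to_renormed c0_pair proj_banach) (fun=> erefl) to_renormed_dense.

End Tensor.

(** * The exposing functional and its unique maximiser *)

Section Exposed.
Variable R : realType.
Notation proj := (@proj_norm R (hexX R) (c0Y R) (pair_alg_tensor R)).
Implicit Types t : c0_pair R.

(* [(z1 - z3, z2 - z3)] is the tensor pairing each vertex [n] with [zn]. *)
Lemma rep_decomp (s : seq (hexX R * c0Y R)) : exists z1 z2 z3 : c0 R,
  \sum_(p <- s) pair_tens p.1 p.2 = (z1 - z3, z2 - z3) :> c0_pair R /\
  c0_renorm z1 + c0_renorm z2 + c0_renorm z3 <= \sum_(p <- s) `|p.1| * `|p.2|.
Proof.
elim: s => [|[x y] s [z1 [z2 [z3 [zE zs]]]]].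
  by exists 0, 0, 0; rewrite !big_nil subrr c0_renorm0 !addr0.
(* Splitting [x] over the three vertices with coefficients [x.1 + r], [x.2 + r], [r] does not
   increase the cost of the term. *)
have [r hr] := hex_norm_decomp x; pose y' : c0 R := y.
exists ((x.1 + r) *: y' + z1), ((x.2 + r) *: y' + z2), (r *: y' + z3).
rewrite !big_cons zE; split.
  apply: injective_projections; rewrite /= opprD addrACA -scalerBl addrK//.
have h (a : R) (z : c0 R) :
    c0_renorm (a *: y' + z) <= `|a| * c0_renorm y' + c0_renorm z.
  by rewrite -c0_renormZ; exact: c0_renormD.
apply: le_trans (lerD (lerD (h _ _) (h _ _)) (h _ _)) _ => /=.
have := lerD (ler_wpM2r (c0_renorm_ge0 y') hr) zs; apply: le_trans.
by rewrite le_eqVlt; apply/orP; left; apply/eqP; ring.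
Qed.

Lemma proj_decomp t (e : R) : 0 < e -> exists z1 z2 z3 : c0 R,
  [/\ t.1 = z1 - z3, t.2 = z2 - z3 &
  c0_renorm z1 + c0_renorm z2 + c0_renorm z3 < proj t + e].
Proof.
move=> e0; have [s [ts se]] := proj_norm_approx (@pair_spanned R) t e0.
have [z1 [z2 [z3 [zE zs]]]] := rep_decomp s.
exists z1, z2, z3; rewrite ts in se *; rewrite [X in X.1]zE [X in X.2]zE.
by split => //; exact: le_lt_trans se.
Qed.

(** The linearisation of [x (x) y |-> x.1 * y 0 + x.2 * y 1], which sends [xn (x) y] to
    [hexf n y]. *)
Definition expose t : R := t.1 0%N + t.2 1%N.

(** Take a vertex representation of cost below [1 + e], and let [a], [b], [c] be the values of
    [hexf]. They sum to at least 1, so [hexf_deviation] leaves at most [e] for the weighted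
    deviations at each [k]; dividing by [weight k] gives the factor [k.+3]. *)
Lemma expose_approx t (e : R) : proj t <= 1 -> 1 <= expose t -> 0 < e ->
  exists a b c : R, 1 <= a + b + c <= 1 + e /\ forall k,
  `|t.1 k - (hexw R V1 k * a - hexw R V3 k * c)| <= k.+3%:R * e /\
  `|t.2 k - (hexw R V2 k * b - hexw R V3 k * c)| <= k.+3%:R * e.
Proof.
move=> t1 ft e0; have [z1 [z2 [z3 [tE1 tE2 zs]]]] := proj_decomp t e0.
have zf := hexf_sum z1 z2 z3.
exists (hexf V1 z1), (hexf V2 z2), (hexf V3 z3).
move: ft; rewrite /expose tE1 tE2 -zf => ft.
have d n z k :
    hexf n z + weight R k * `|z k - hexw R n k * hexf n z| <= c0_renorm z.
  apply: le_trans (hexf_deviation n z k); rewrite lerD2r; exact: ler_norm.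
have dpos n (z : c0 R) k : 0 <= weight R k * `|z k - hexw R n k * hexf n z|.
  by rewrite mulr_ge0// ltW// weight_gt0.
have eqk k (z : R) : (z <= k.+3%:R * e) = (weight R k * z <= e).
  by rewrite /weight ler_pdivrMl.
split.
  rewrite ft /=; have := d V1 z1 0%N; have := d V2 z2 0%N; have := d V3 z3 0%N.
  have := dpos V1 z1 0%N; have := dpos V2 z2 0%N; have := dpos V3 z3 0%N.
  lra.
move=> k; rewrite !eqk !c0D !c0N.
have := d V1 z1 k; have := d V2 z2 k; have := d V3 z3 k.
have := dpos V1 z1 k; have := dpos V2 z2 k; have := dpos V3 z3 k.
have wk := weight_gt0 R k.
move: (hexw _ _ _ * _) (hexw _ _ _ * _) (hexw _ _ _ * _) => w1 w2 w3.
have tri (p q r s : R) : weight R k * `|p - q - (r - s)| <=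
    weight R k * `|p - r| + weight R k * `|q - s|.
  rewrite -mulrDr ler_pM2l//.
  have -> : p - q - (r - s) = (p - r) - (q - s) by ring.
  exact: ler_normB.
have := tri (z1 k) (z3 k) w1 w3; have := tri (z2 k) (z3 k) w2 w3.
by split; lra.
Qed.

(** The sum of the [xn (x) wn] with coefficients 1/3: its components are [(w1 - w3)/3] and
    [(w2 - w3)/3], where the constant tails cancel. *)
Definition exposed_pair : c0_pair R :=
  (finite_c0 (fun k => if k == 0%N then 2^-1 else 0) 2,
   finite_c0 (fun k => if k == 1%N then 2^-1 else 0) 2).

Lemma expose_exposed_pair : expose exposed_pair = 1.
Proof. by rewrite /expose /exposed_pair /= !finite_c0E /=; lra. Qed.

Lemma eq_of_small (a b C : R) :
  (forall e : R, 0 < e -> `|a - b| <= C * e) -> a = b.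
Proof.
move=> ab; apply/eqP; rewrite -subr_eq0 -normr_le0; apply/ler_addgt0Pr => e e0.
have C1 : 0 < `|C| + 1 by rewrite ltr_wpDl.
rewrite add0r; apply: le_trans (ab _ (divr_gt0 e0 C1)) _.
rewrite mulrA ler_pdivrMr// mulrC ler_wpM2l ?ltW//.
by apply: le_lt_trans (ler_norm _) _; rewrite ltrDl.
Qed.

Lemma c0_eventually_const (x : c0 R) (a : R) K :
  (forall k, (K <= k)%N -> x k = a) -> a = 0.
Proof.
move=> xa; have x_a : x n @[n --> \oo] --> a.
  apply: cvg_near_cst; exists K => // k /= Kk; exact: xa.
exact: cvg_unique x_a (@c0_cvg _ x).
Qed.

(** From index 2 on, [t] is approximated by the constants [a - c] and [b - c]. Nullity forces these
    to be small, so [a], [b], [c] are all near 1/3, which determines the first two coordinates. *)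
Lemma expose_unique t : proj t <= 1 -> 1 <= expose t -> t = exposed_pair.
Proof.
move=> t1 ft.
(* The errors are [(k + 5) * e] at index [k + 2] and [5 * e] at index 2. *)
have cst k : t.1 k.+2 = t.1 2%N /\ t.2 k.+2 = t.2 2%N.
  split; apply: (@eq_of_small _ _ (k.+2.+3%:R + 5)) => e e0; rewrite mulrDl;
  have [a [b [c [_ abc]]]] := expose_approx t1 ft e0;
  have [] := abc k.+2; have [] := abc 2%N; rewrite /hexw !mul1r;
  move: (k.+2.+3%:R * e) => E; rewrite !ler_norml;
  move=> /andP[? ?] /andP[? ?] /andP[? ?] /andP[? ?]; apply/andP; split; lra.
(* As [t] is null, the coefficients [a], [b], [c] are almost equal. *)
have tail0 (x : c0 R) : (forall k, x k.+2 = x 2%N) -> forall k, x k.+2 = 0.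
  move=> xc k; rewrite xc; apply: (@c0_eventually_const x _ 2).
  by case=> [|[|l]] // _; exact: xc.
have z1 := tail0 t.1 (fun k => (cst k).1).
have z2 := tail0 t.2 (fun k => (cst k).2).
(* The bounds 3, 4 and 5 times [e] come from indices 0, 1 and 2; the factor 20 is a generous common
   bound. *)
have head (x y : R) : (forall e a b c : R, 0 < e -> 1 <= a + b + c <= 1 + e ->
    `|a - c| <= 5 * e -> `|b - c| <= 5 * e ->
    `|t.1 0%N - (hexw R V1 0 * a - hexw R V3 0 * c)| <= 3 * e ->
    `|t.1 1%N - (hexw R V1 1 * a - hexw R V3 1 * c)| <= 4 * e ->
    `|t.2 0%N - (hexw R V2 0 * b - hexw R V3 0 * c)| <= 3 * e ->
    `|t.2 1%N - (hexw R V2 1 * b - hexw R V3 1 * c)| <= 4 * e ->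
    `|x - y| <= 20 * e) -> x = y.
  move=> xy; apply: (@eq_of_small _ _ 20) => e e0.
  have [a [b [c [s abc]]]] := expose_approx t1 ft e0.
  have [a0 b0] := abc 0%N; have [a1 b1] := abc 1%N.
  have [a2 b2] := abc 2%N; rewrite /= z1 in a2; rewrite /= z2 in b2.
  apply: (xy e a b c) => //.
  - by move: a2; rewrite !mul1r sub0r normrN.
  - by move: b2; rewrite !mul1r sub0r normrN.
apply: injective_projections; apply: c0P => -[|[|k]]; rewrite ?z1 ?z2 //;
  rewrite finite_c0E /=; apply: head => e a b c e0 /= /andP[? ?];
  rewrite !ler_norml => /andP[? ?] /andP[? ?] /andP[? ?] /andP[? ?];
  move=> /andP[? ?] /andP[? ?];
  apply/andP; split; lra.
Qed.

(** Replacing each [wn] by its truncation at [K] still represents the same tensor, because the tails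
    cancel, at cost at most [1 + weight K]; then [K] tends to infinity. *)
Lemma proj_exposed_pair : proj exposed_pair <= 1.
Proof.
have K_le K : (2 <= K)%N -> proj exposed_pair <= 1 + weight R K.
  move=> K2.
  pose z n : c0 R := 3^-1 *: finite_c0 (hexw R n) K.
  have -> : exposed_pair = pair_tens (hexv R V1 : hexX R) (z V1 : c0Y R) +
     pair_tens (hexv R V2 : hexX R) (z V2 : c0Y R) +
     pair_tens (hexv R V3 : hexX R) (z V3 : c0Y R).
    apply: injective_projections; apply: c0P => k;
    rewrite /= !c0D !c0Z !finite_c0E;
    case: k => [|[|k]]; rewrite ?(ltnW K2) ?K2 /=; try lra;
    by case: ifP => _; lra.
  apply: le_trans (proj_normD (@pair_spanned R) _ _) _.
  apply: le_trans (lerD (proj_normD (@pair_spanned R) _ _) (lexx _)) _.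
  have le n : proj (pair_tens (hexv R n : hexX R) (z n : c0Y R)) <=
      3^-1 * (1 + weight R K).
    apply: le_trans (proj_pair_tens _ _) _.
    rewrite c0_renormZ ger0_norm ?invr_ge0// ler_wpM2l ?invr_ge0//.
    exact: c0_renorm_hexw.
  apply: le_trans (lerD (lerD (le _) (le _)) (le _)) _; lra.
apply/ler_addgt0Pr => e e0.
have [K _ Ke] := near_infty_natSinv_lt (PosNum e0).
apply: le_trans (K_le K.+2 _) _ => //; rewrite lerD2l.
(* The shift matches the inverse of [K.+4.+1] with [weight K.+2]. *)
by apply: ltW; apply: (Ke K.+4); rewrite /= !leqW.
Qed.

End Exposed.

(** * Assembling the spaces, the functional and the rank argument *)

Section Main.
Variable R : realType.

Lemma hexX_dim : has_dim 2 (hexX R).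
Proof.
constructor.
exists (fun p : R * R => \row_(j < 2) (if j == 0 then p.1 else p.2)).
  by move=> a p q; apply/rowP => j; rewrite !mxE; case: ifP.
exists (fun M : 'rV[R]_2 => (M 0 0, M 0 1)) => [[a b]|M]; first by rewrite !mxE.
apply/rowP => -[[|[|//]] j]; rewrite mxE /=; congr (M _ _); exact: val_inj.
Qed.

Lemma c0Y_renorming : renorming_of_c0 (c0Y R).
Proof.
exists (@to_renormed R _ (c0_banach R)); split; first by exists id.
exists 1, 3; split=> // x; rewrite mul1r.
by rewrite [`|_|]/(c0_renorm x) c0_norm_le_renorm c0_renorm_le_norm.
Qed.

Definition exposeP (t : pairP R) : R^o := expose (t : c0_pair R).

Fact exposeP_linear : linear exposeP.
Proof.
by move=> a t u; rewrite /exposeP /expose /= !c0D !c0Z scalerDr addrACA.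
Qed.

HB.instance Definition _ :=
  GRing.isLinear.Build R (pairP R) R^o *:%R exposeP exposeP_linear.

Lemma exposeP_continuous : continuous exposeP.
Proof.
apply: bounded_linear_continuous; apply/linear_boundedP.
exists 2; split => // r r2 t; apply: le_trans (ler_normD _ _) _.
have [t1 t2] := proj_component (t : c0_pair R).
have le k (x : c0 R) : `|x k| <= c0_renorm x := le_c0_renorm (inl k) x.
have h := lerD (le_trans (le 0%N _) t1) (le_trans (le 1%N _) t2).
apply: le_trans h _; rewrite -mulr2n -mulr_natl.
by apply: ler_wpM2r; [exact: (normr_ge0 t) | exact: ltW].
Qed.

End Main.

Theorem theorem1 (R : realType) :
  exists (X Y : completeNormedModType R) (P : proj_tensor X Y) (u : P),
    [/\ has_dim 2 X,
        renorming_of_c0 Y,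
        exposed_point (unit_ball (E := P)) u &
        ~ exists (x : X) (y : Y), u = elementary_tensor P x y].
Proof.
exists (hexX R), (c0Y R), (pair_proj_tensor R), (exposed_pair R).
split; [exact: hexX_dim | exact: c0Y_renorming | |].
- split; first exact: proj_exposed_pair.
  exists (@exposeP R); split => [|t t1 tu]; first exact: exposeP_continuous.
  change (expose (t : c0_pair R) < expose (exposed_pair R)).
  rewrite expose_exposed_pair ltNge; apply/negP => ft.
  by apply: tu; exact: expose_unique.
move=> [x [y uE]].
have u1 k : (exposed_pair R).1 k = x.1 * (y : c0 R) k.
  exact: (congr1 (fun t : c0_pair R => t.1 k) uE).
have u2 k : (exposed_pair R).2 k = x.2 * (y : c0 R) k.
  exact: (congr1 (fun t : c0_pair R => t.2 k) uE).
have := u1 0%N; have := u1 1%N; have := u2 1%N.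
rewrite !finite_c0E /= => yB y1A yA.
(* The vanishing entry [x.1 * y 1] kills one factor, but [x.1 * y 0] and [x.2 * y 1] both equal
   1/2. *)
move/esym/eqP: y1A; rewrite mulf_eq0 => /orP[] /eqP e0.
  by move: yA; rewrite e0 mul0r; lra.
by move: yB; rewrite e0 mulr0; lra.
Qed.
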